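(* Let $W$ be a Coxeter group with finite generating set $S$ and let $I(W)$ be its subset of involutions. The set $W^{CFC}\cap I(W)$ is finite. Moreover, an element $w\in W$ belongs to $W^{CFC}\cap I(W)$ if and only if for any generator $s$ in $supp(w)$, $|w_s|=1$ and, for all $t\in S$ such that $m_{st}\ge 3$, $|w_t|=0$ (i.e. two non-commuting generators cannot both occur in $w$).
   Context: $(m_{st})_{s,t\in S}$ is the Coxeter matrix of $(W,S)$ (with $m_{st}=\infty$ allowed, counted as $\ge3$). $I(W)=\{w\in W: w^2=1\}$ (including the identity). An element of $W$ is fully commutative (FC) if any two of its reduced expressions are related by a sequence of transpositions of adjacent commuting generators. A cyclic shift of a word $s_{i_1}\cdots s_{i_k}$ is any word $s_{i_j}\cdots s_{i_k}s_{i_1}\cdots s_{i_{j-1}}$. An element is cyclically fully commutative (CFC) if every cyclic shift of every one of its reduced expressions is a reduced expression of an FC element; $W^{CFC}$ is the set of CFC elements. $supp(w)$ is the set of generators appearing in a (equivalently any) reduced expression of $w$, and $|w_s|$ is the number of occurrences of $s$ in a reduced expression of $w$ (independent of the reduced expression when $w$ is FC; in the characterization the condition may be read for some, equivalently any, reduced expression of $w$). *)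

(* Defs.v *)
From HB Require Import structures.
From Stdlib Require Export Relations.
From mathcomp Require Export all_boot monoid.
From mathcomp Require Export boolp classical_sets cardinality.

Set Implicit Arguments.
Unset Strict Implicit.
Unset Printing Implicit Defensive.

Local Open Scope group_scope.
Local Open Scope classical_set_scope.

(* [None] stands for m_st = oo. *)
Record coxeter_matrix (S : finType) := CoxeterMatrix {
  cox_entry :> S -> S -> option nat;
  cox_entryC : forall s t, cox_entry s t = cox_entry t s;
  cox_entry_gt0 : forall s t, cox_entry s t <> Some 0%N;
  cox_entry_eq1 : forall s t, cox_entry s t = Some 1%N <-> s = t }.

Definition cox_ge3 (S : finType) (m : coxeter_matrix S) (s t : S) : bool :=
  if m s t is Some n then 3 <= n else true.

(* Deletion of a factor (st)^{m_st}. Since m_ss = 1, the factors ss can be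
   deleted, so that formal inverses of generators are not needed: the words in S
   modulo the equivalence relation generated by these deletions are the elements
   of the group < S | (st)^{m_st} = 1 whenever m_st is finite >. *)
Inductive cox_delete (S : finType) (m : coxeter_matrix S) :
    seq S -> seq S -> Prop :=
  CoxDelete (a b : seq S) (s t : S) (n : nat) of m s t = Some n :
    cox_delete m (a ++ flatten (nseq n [:: s; t]) ++ b) (a ++ b).

Section CoxeterGroup.
Variables (S : finType) (W : groupType) (r : S -> W).

Definition word_val (u : seq S) : W := \big[*%g/1]_(s <- u) r s.

(* W is a Coxeter group with matrix m, the generator s : S being r s : W. That r
   is injective and that r s * r t has order m s t are consequences. *)
Definition coxeter_system (m : coxeter_matrix S) : Prop :=
  (forall w : W, exists u, word_val u = w) /\
  (forall u v, word_val u = word_val v <->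
     clos_refl_sym_trans (seq S) (cox_delete m) u v).

Definition reduced_expr (u : seq S) (w : W) : Prop :=
  word_val u = w /\ forall v, word_val v = w -> size u <= size v.

Inductive comm_swap : seq S -> seq S -> Prop :=
  CommSwap (a b : seq S) (s t : S) of commute (r s) (r t) :
    comm_swap (a ++ [:: s, t & b]) (a ++ [:: t, s & b]).

Definition fully_commutative (w : W) : Prop :=
  forall u v, reduced_expr u w -> reduced_expr v w ->
    clos_refl_trans (seq S) comm_swap u v.

Definition CFC : set W :=
  [set w | forall u, reduced_expr u w -> forall k : nat,
     exists2 x, fully_commutative x & reduced_expr (rot k u) x].

End CoxeterGroup.

Definition involutions (W : groupType) : set W := [set w | w ^+ 2 = 1].
Arguments involutions W : clear implicits.

(* The presentation has its universal property. *)
Lemma coxeter_system_lift (S : finType) (m : coxeter_matrix S) (W : groupType)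
    (r : S -> W) (G : groupType) (f : S -> G) :
  coxeter_system r m ->
  (forall s t n, m s t = Some n -> (f s * f t) ^+ n = 1) ->
  exists! h : W -> G,
    (forall x y, h (x * y) = h x * h y) /\ (forall s, h (r s) = f s).
Proof.
move=> [gen rel] fm.
have catE (H : groupType) (g : S -> H) u v :
    word_val g (u ++ v) = word_val g u * word_val g v.
  by rewrite /word_val big_cat.
have fE u v : word_val r u = word_val r v -> word_val f u = word_val f v.
  move/rel; elim=> {u v} [_ _ [a b s t n mst]|//|u v _ ->//|u v w _ -> _ ->//].
  rewrite !catE (_ : word_val f (flatten _) = 1) ?mul1g //.
  rewrite -(fm s t n mst) /word_val; elim: n {mst} => [|n IH].
    by rewrite big_nil.
  by rewrite /= !big_cons IH expgS mulgA.
have ex w : exists u, word_val r u == w.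
  by have [u <-] := gen w; exists u.
pose h w := word_val f (xchoose (ex w)).
have hE u : h (word_val r u) = word_val f u.
  by apply: fE; apply/eqP/(xchooseP (ex _)).
exists h; split; first split.
- move=> x y; have [[u <-] [v <-]] := (gen x, gen y).
  by rewrite -catE !hE catE.
- by move=> s; have := hE [:: s]; rewrite /word_val !big_seq1.
move=> k [kM kr]; apply/funext => w; have [u <-] := gen w; rewrite hE.
rewrite /word_val; elim: u => [|s u IH]; last by rewrite !big_cons kM kr -IH.
by rewrite !big_nil; apply: (mulIg (k 1)); rewrite -kM !mul1g.
Qed.

(* Main.v *)
Require Import Defs.
From mathcomp Require Import ssralg poly ssrnum algC cyclotomic ring.

Set Implicit Arguments.
Unset Strict Implicit.
Unset Printing Implicit Defensive.

Local Open Scope group_scope.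
Local Open Scope classical_set_scope.

(** Call a word isolated when its letters are distinct and pairwise commuting;
    the theorem says that the elements in question are those of isolated reduced
    words.

    Let [u] be a reduced word of a CFC involution [w]. The reversal of [u] is a
    reduced word of the inverse of [w], which is [w]; hence, [w] being fully
    commutative, commutations lead from [u] to its reversal, and the subword of
    [u] on any two noncommuting generators is a palindrome. Let [a] be the first
    letter of [u]. By the palindromes nothing that fails to commute with [a]
    occurs after the last [a]. If [a] occurred twice, the last [a] could
    therefore be moved to the end, and a cyclic shift would contain the square
    of [a], which is not reduced ([first_letter_once]). So [a] occurs once and
    commutes with the rest of [u] ([first_letter_central]). Shifting [u] by one
    letter then gives another reduced word of the same [w], which makes every
    letter of [u] the first letter of such a word ([rot_reduced]), and [u] is
    isolated ([CFC_involution_isolated]).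

    Conversely, the value of an isolated word is a product of commuting
    involutions. The words of the same letters in any order are related by
    commutations, so everything follows once these are known to be the only
    reduced words of the element ([reduced_expr_perm]). This, and the fact that
    generators with entry at least 3 do not commute, are statements that
    something does not hold in the group, and they are read off a reflection
    representation: its roots are linearly independent, a word moves a vector
    only along the roots of its letters, and an isolated word negates the root
    of each of its letters; so any word of the same value contains all these
    letters ([isolated_support]), and no others if it is as short.

    Finiteness holds because an isolated word is determined, up to the order of
    its letters, by a subset of the finite set of generators. *)

(** * Reflections attached to a matrix of coefficients *)

Section Reflections.
Import GRing.Theory.
Local Open Scope ring_scope.
Variables (S : finType) (F : fieldType) (c : S -> S -> F).
Implicit Types (s t : S) (v : {ffun S -> F}).

(** The vector v + a * alpha_s, where alpha_s is the simple root of [s]. *)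
Definition root_shift (a : F) s v : {ffun S -> F} :=
  [ffun x => v x + a * (x == s)%:R].

Definition simple_root s : {ffun S -> F} := [ffun x => (x == s)%:R].

Definition coroot s v : F := \sum_t c s t * v t.

Definition reflection s v := root_shift (coroot s v) s v.

Definition word_act (u : seq S) v := foldr reflection v u.

Lemma word_act_cat u1 u2 v :
  word_act (u1 ++ u2) v = word_act u1 (word_act u2 v).
Proof. exact: foldr_cat. Qed.

Lemma coroot_simple_root s t : coroot s (simple_root t) = c s t.
Proof.
rewrite /coroot (bigD1 t) //= ffunE eqxx mulr1 big1 ?addr0 // => x /negPf xt.
by rewrite ffunE xt mulr0.
Qed.

Lemma coroot_shift s a t v :
  coroot s (root_shift a t v) = coroot s v + a * c s t.
Proof.
rewrite -(coroot_simple_root s t) /coroot mulr_sumr -big_split.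
by apply: eq_bigr => x _; rewrite !ffunE /=; ring.
Qed.

Lemma reflectionK s : c s s = - 2%:R -> involutive (reflection s).
Proof.
move=> css v; rewrite {1}/reflection coroot_shift css.
by apply/ffunP => x; rewrite !ffunE; ring.
Qed.

(** The orbit of [v] stays in the plane through [v] spanned by the two simple
    roots. On the pair of coroots of [s] and [t], the product of the two
    reflections has the eigenvalues z^2 and z^-2, so its n-th power preserves
    both coroots; and a vector of the span of the roots that both coroots kill
    is zero, the determinant 4 - (z + 1/z)^2 = - (z - 1/z)^2 being nonzero. *)
Lemma dihedral_relation s t (z : F) n v :
    c s s = - 2%:R -> c t t = - 2%:R ->
    c s t = z + z^-1 -> c t s = z + z^-1 ->
    z != 0 -> z ^+ 2 != 1 -> z ^+ n.*2 = 1 ->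
  word_act (flatten (nseq n [:: s; t])) v = v.
Proof.
move=> css ctt cst cts z0 z2 zn.
pose orb k := word_act (flatten (nseq k [:: s; t])) v.
have orbS k : orb k.+1 = reflection s (reflection t (orb k)) by [].
have [a [b orbn]] : exists a b, orb n = root_shift a s (root_shift b t v).
  elim: (n) => [|k [a [b IH]]].
    by exists 0, 0; apply/ffunP => x; rewrite !ffunE !mul0r !addr0.
  exists (a + coroot s (reflection t (orb k))), (b + coroot t (orb k)).
  by rewrite orbS; apply/ffunP => x; rewrite !ffunE IH !ffunE; ring.
(* The left eigenvectors are x + z y and x + y / z, where x and y are the
   coroots of s and t. *)
have eigen e k : e = z \/ e = z^-1 ->
    coroot s (orb k) + e * coroot t (orb k) =
    e ^+ k.*2 * (coroot s v + e * coroot t v).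
  move=> ez; elim: k => [|k IH]; first by rewrite mul1r.
  rewrite orbS !coroot_shift css ctt cst cts doubleS !exprS -mulrA -mulrA -IH.
  by case: ez => ->; field.
have fixed e : e = z \/ e = z^-1 ->
    (a * - 2%:R + b * (z + z^-1)) + e * (a * (z + z^-1) + b * - 2%:R) = 0.
  move=> ez; have := eigen e n ez.
  have -> : e ^+ n.*2 = 1 by case: ez => -> //; rewrite exprVn zn invr1.
  rewrite orbn !coroot_shift css ctt cst cts mul1r.
  by move/eqP; rewrite -subr_eq0 => /eqP <-; ring.
have E1 := fixed z (or_introl erefl).
have E2 := fixed z^-1 (or_intror erefl).
have z21 : z ^+ 2 - 1 != 0 by rewrite subr_eq0.
(* E1 and E2 read (z^2 - 1) (a - b / z) = 0 and (z^-2 - 1) (a - b z) = 0; the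
   combination below eliminates a. *)
have b0 : b = 0.
  have : b * (z ^+ 2 - 1) ^+ 2 == z * 0 + z ^+ 3 * 0.
    by rewrite -{1}E1 -E2; apply/eqP; field.
  by rewrite !mulr0 addr0 mulf_eq0 expf_eq0 /= (negPf z21) orbF => /eqP.
have a0 : a = 0.
  have : a * (z ^+ 2 - 1) == 0 by rewrite -E1 b0; apply/eqP; field.
  by rewrite mulf_eq0 (negPf z21) orbF => /eqP.
rewrite -/(orb n) orbn a0 b0; apply/ffunP => x.
by rewrite !ffunE !mul0r !addr0.
Qed.

Lemma word_act_notin j u v : j \notin u -> word_act u v j = v j.
Proof.
elim: u => //= s u IH; rewrite inE negb_or => /andP[/negPf js ju].
by rewrite ffunE js mulr0 addr0 IH.
Qed.

Lemma word_act_orthogonal j u : {in u, forall s, c s j = 0} ->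
  word_act u (simple_root j) = simple_root j.
Proof.
elim: u => //= s u IH cu0; rewrite IH => [|t tu]; last first.
  by apply: cu0; rewrite inE tu orbT.
rewrite /reflection coroot_simple_root cu0 ?mem_head //.
by apply/ffunP => x; rewrite !ffunE mul0r addr0.
Qed.

End Reflections.

(** * The reflection representation of a Coxeter group *)

Section TitsRepresentation.
Import GRing.Theory Num.Theory.
Local Open Scope ring_scope.
Variables (S : finType) (m : coxeter_matrix S).

(** Among the 2n-th roots of unity since its square has to have order n. The
    truncation [n.-1.+1] turns the index 0, which no Coxeter entry takes, into
    1. *)
Definition half_angle_root (n : nat) : algC :=
  sval (C_prim_root_exists (isT : (0 < n.-1.+1.*2)%N)).

Lemma half_angle_root_prim n :
  (0 < n)%N -> n.*2.-primitive_root (half_angle_root n).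
Proof.
by rewrite /half_angle_root; case: n => // n _; case: C_prim_root_exists.
Qed.

Lemma half_angle_root_neq0 n : (0 < n)%N -> half_angle_root n != 0.
Proof.
move=> n0; apply/eqP => z0; have := prim_expr_order (half_angle_root_prim n0).
by rewrite z0 expr0n double_eq0 eqn0Ngt n0 => /esym/eqP; rewrite oner_eq0.
Qed.

Lemma half_angle_root_sqr n : (1 < n)%N -> half_angle_root n ^+ 2 != 1.
Proof.
move=> n1; rewrite -(prim_order_dvd (half_angle_root_prim (ltnW n1))).
by case: n n1 => [|[|n]] // _; rewrite gtnNdvd.
Qed.

(** The value 2 cos(pi / m) of the classical geometric representation, up to a
    Galois conjugation; for an infinite entry any nonzero value would do, as no
    relation has to hold. *)
Definition cox_coef (s t : S) : algC :=
  if m s t is Some n then half_angle_root n + (half_angle_root n)^-1 else 2%:R.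

Lemma cox_coefC s t : cox_coef s t = cox_coef t s.
Proof. by rewrite /cox_coef cox_entryC. Qed.

(** The primitive square root of unity is -1. *)
Lemma cox_coef_diag s : cox_coef s s = - 2%:R.
Proof.
rewrite /cox_coef (cox_entry_eq1 m s s).2 //.
have z2 := half_angle_root_prim (isT : (0 < 1)%N).
move: z2 (prim_expr_order z2).
move: (half_angle_root 1) => z z2 /eqP; rewrite sqrf_eq1 => /orP[]/eqP z1.
  by have := prim_order_dvd z2 1; rewrite z1 eqxx.
by rewrite z1 invrN invr1 -opprD.
Qed.

Lemma cox_entry_gt1 s t n : s != t -> m s t = Some n -> (1 < n)%N.
Proof.
move=> st; case: n => [/cox_entry_gt0//|[/cox_entry_eq1/eqP|//]].
by rewrite (negPf st).
Qed.

(** The sum z + 1/z vanishes exactly when z has order 4. *)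
Lemma cox_coef_eq0 s t : s != t -> (cox_coef s t == 0) = ~~ cox_ge3 m s t.
Proof.
move=> st; rewrite /cox_coef /cox_ge3; case mst: (m s t) => [n|]; last first.
  by rewrite pnatr_eq0.
have n1 := cox_entry_gt1 st mst; have z21 := half_angle_root_sqr n1.
have z0 := half_angle_root_neq0 (ltnW n1).
have <- : (half_angle_root n ^+ 4 == 1) = ~~ (2 < n)%N.
  rewrite -(prim_order_dvd (half_angle_root_prim (ltnW n1))).
  by case: n n1 {mst z0 z21} => [|[|[|n]]] // _; rewrite gtnNdvd.
move: (half_angle_root n) z0 z21 => z z0 z21.
apply/idP/idP => [/eqP zz|].
  have : z * (z + z^-1) * (z ^+ 2 - 1) == 0 by rewrite zz mulr0 mul0r.
  by rewrite -[in X in _ -> X]subr_eq0 => /eqP <-; apply/eqP; field.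
rewrite (exprM z 2 2) sqrf_eq1 (negPf z21) /= => /eqP zz.
rewrite -(mulrI_eq0 _ (mulfI z0)) mulrDr mulfV //; apply/eqP.
by rewrite -expr2 zz addNr.
Qed.

Lemma cox_delete_act u v : clos_refl_sym_trans (seq S) (cox_delete m) u v ->
  word_act cox_coef u =1 word_act cox_coef v.
Proof.
elim=> {u v} [_ _ [a b s t n mst]|//|u v _ IH x|u v w _ IH1 _ IH2 x]; last first.
- by rewrite IH1.
- by rewrite IH.
move=> x; rewrite !word_act_cat; congr word_act; move: (word_act _ b x) => {}x.
case: (eqVneq s t) mst => [<-|st] mst.
  have := (cox_entry_eq1 m s s).2 erefl; rewrite mst => -[->] /=.
  by rewrite reflectionK ?cox_coef_diag.
have n1 := cox_entry_gt1 st mst; have n0 := ltnW n1.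
apply: (@dihedral_relation _ _ _ s t (half_angle_root n)).
- exact: cox_coef_diag.
- exact: cox_coef_diag.
- by rewrite /cox_coef mst.
- by rewrite cox_coefC /cox_coef mst.
- exact: half_angle_root_neq0.
- exact: half_angle_root_sqr.
- exact/prim_expr_order/half_angle_root_prim.
Qed.

End TitsRepresentation.

(** * Words in a Coxeter system *)

Section CoxeterSystem.
Variables (S : finType) (m : coxeter_matrix S) (W : groupType) (r : S -> W).
Hypothesis rm : coxeter_system r m.
Implicit Types (s t : S) (u v : seq S) (w : W).

Lemma word_val_act u v : word_val r u = word_val r v ->
  word_act (cox_coef m) u =1 word_act (cox_coef m) v.
Proof. by move/(rm.2 u v).1/cox_delete_act. Qed.

Lemma word_val_cons s u : word_val r (s :: u) = r s * word_val r u.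
Proof. exact: big_cons. Qed.

Lemma word_val_cat u v : word_val r (u ++ v) = word_val r u * word_val r v.
Proof. exact: big_cat. Qed.

Lemma word_val1 s : word_val r [:: s] = r s.
Proof. exact: big_seq1. Qed.

Lemma word_val_nil : word_val r [::] = 1.
Proof. exact: big_nil. Qed.

Lemma cox_relation s t n : m s t = Some n ->
  word_val r (flatten (nseq n [:: s; t])) = 1.
Proof.
move=> mst; rewrite -word_val_nil; apply/(rm.2 _ _).2/rst_step.
by have := CoxDelete [::] [::] mst; rewrite cats0.
Qed.

Lemma gen_sqr s : r s * r s = 1.
Proof.
have := cox_relation ((cox_entry_eq1 m s s).2 erefl).
by rewrite /= word_val_cons word_val1.
Qed.

Lemma gen_inv s : (r s)^-1 = r s.
Proof. by apply: (mulgI (r s)); rewrite gen_sqr mulgV. Qed.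

Lemma word_val_rev u : word_val r (rev u) = (word_val r u)^-1.
Proof.
elim: u => [|s u IH]; first by rewrite word_val_nil invg1.
by rewrite rev_cons -cats1 word_val_cat IH word_val1 word_val_cons invgM gen_inv.
Qed.

(** If the two generators commute, the images of alpha_s under the two products
    of reflections agree; their coordinates at [t] are c and -c, where c is the
    coefficient of the pair, so that c vanishes. *)
Lemma commute_gen s t : commute (r s) (r t) <-> ~~ cox_ge3 m s t.
Proof.
case: (eqVneq s t) => [<-|st].
  by split=> // _; rewrite /cox_ge3 (cox_entry_eq1 m s s).2.
split=> [st_comm|].
  rewrite -(cox_coef_eq0 m st).
  have := @word_val_act [:: s; t] [:: t; s].
  rewrite !word_val_cons word_val_nil !mulg1 => /(_ st_comm).
  move=> /(_ (simple_root _ s)) /ffunP /(_ t).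
  have nst : (t == s) = false by rewrite eq_sym (negPf st).
  rewrite /= /reflection !coroot_shift !coroot_simple_root cox_coef_diag.
  rewrite (cox_coefC m t s) !ffunE eqxx nst.
  move: (cox_coef m s t) => c.
  rewrite !(GRing.mulr0, GRing.mulr1, GRing.add0r, GRing.addr0).
  move/eqP; rewrite -GRing.subr_eq0 => /eqP cc.
  have : (c *+ 2 == 0)%R by apply/eqP; rewrite -cc; ring.
  by rewrite Num.Theory.mulrn_eq0.
rewrite /cox_ge3; case mst: (m s t) => [n|] //; have := cox_relation mst.
have := cox_entry_gt1 st mst.
case: n {mst} => [|[|[|n]]] // _.
rewrite /= !word_val_cons word_val_nil mulg1 => stst _.
apply: (mulgI (r s * r t)).
by rewrite -[X in _ = _ * (X * _)]gen_inv -[X in _ = _ * (_ * X)]gen_inv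
   -invgM mulgV -mulgA.
Qed.

(** * Commutation classes of words *)

Notation swaps := (clos_refl_trans (seq S) (comm_swap r)).

Lemma swaps_val u v : swaps u v -> word_val r u = word_val r v.
Proof.
elim=> {u v} [_ _ [a b s t st]|//|u v w _ -> _ -> //].
by rewrite !word_val_cat !word_val_cons !mulgA -(mulgA _ (r s)) st mulgA.
Qed.

Lemma swaps_cat a b u v : swaps u v -> swaps (a ++ u ++ b) (a ++ v ++ b).
Proof.
elim=> {u v} [_ _ [c d s t st]|u|u v w _ uv _ vw]; last exact: rt_trans vw.
- by apply: rt_step; rewrite -!catA !cat_cons !(catA a c); apply: CommSwap.
- exact: rt_refl.
Qed.

Lemma swaps_front s u : {in u, forall t, commute (r s) (r t)} ->
  swaps (s :: u) (rcons u s).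
Proof.
elim: u => [|t u IH] su; first exact: rt_refl.
apply: (rt_trans _ _ _ [:: t, s & u]).
  by apply/rt_step/(CommSwap [::]); apply: su; rewrite mem_head.
have := @swaps_cat [:: t] [::] _ _ (IH _); rewrite !cats0; apply=> x xu.
by apply: su; rewrite inE xu orbT.
Qed.

(** The first letter of [u] can be moved to the front of [v]. *)
Lemma perm_swaps u v : {in u &, forall s t, commute (r s) (r t)} ->
  perm_eq u v -> swaps u v.
Proof.
elim: u v => [|s u IH] v uC uv.
  by have := perm_size uv; case: v {uv} => // _; apply: rt_refl.
have sv : s \in v by rewrite -(perm_mem uv) mem_head.
have sC : {in v, forall t, commute (r s) (r t)}.
  by move=> t; rewrite -(perm_mem uv) => tu; apply: uC; rewrite ?mem_head.
case/splitPr: sv uv sC => a b uv sC.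
apply: (rt_trans _ _ _ (s :: a ++ b)).
  have := @swaps_cat [:: s] [::] _ _ (IH (a ++ b) _ _); rewrite !cats0; apply.
    by move=> x y xu yu; apply: uC; rewrite inE ?xu ?yu orbT.
  by have := uv; rewrite perm_sym (perm_catCA a [:: s] b) perm_cons perm_sym.
rewrite -cat_cons -(cat1s s b) catA cats1.
apply: (@swaps_cat [::] b (s :: a) (rcons a s)); apply: swaps_front => t ta.
by apply: sC; rewrite mem_cat ta.
Qed.

Lemma swaps_filter s t u v : ~ commute (r s) (r t) -> swaps u v ->
  filter (pred2 s t) u = filter (pred2 s t) v.
Proof.
move=> st; elim=> {u v} [_ _ [a b x y xy]|//|u v w _ -> _ -> //].
rewrite !filter_cat /=; case: (eqVneq x s) xy => [->|xs] xy /=.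
  case: (eqVneq y s) xy => [-> //|ys] xy /=.
  by case: (eqVneq y t) xy => [-> //|yt] xy /=.
case: (eqVneq x t) xy => [->|xt] xy //=.
case: (eqVneq y s) xy => [->|ys] xy /=; first by case: st; apply/esym.
by case: (eqVneq y t) xy => [-> //|yt] xy /=.
Qed.

(** * Isolated words *)

Definition isolated u := forall x, x \in u ->
  count_mem x u = 1%N /\ forall y, cox_ge3 m x y -> count_mem y u = 0%N.

Lemma isolated_uniq u : isolated u -> uniq u.
Proof.
move=> iu; apply/count_mem_uniq => s; case: (boolP (s \in u)) => [/iu[]//|su].
exact/count_memPn.
Qed.

Lemma isolated_ge3 u : isolated u ->
  {in u &, forall s t, ~~ cox_ge3 m s t}.
Proof.
move=> iu s t /iu[_ su] tu; apply/negP => /su /eqP.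
by rewrite -leqn0 leqNgt -has_count has_pred1 tu.
Qed.

Lemma isolated_commute u : isolated u ->
  {in u &, forall s t, commute (r s) (r t)}.
Proof. by move=> iu s t su tu; apply/commute_gen/(isolated_ge3 iu). Qed.

(** The letter [j] of [u] occurs once and the root alpha_j is orthogonal to the
    roots of the other letters, so [u] maps the coordinate of alpha_j at [j] to
    its opposite -1; a word without [j] leaves it equal to 1. *)
Lemma isolated_support u v : isolated u -> word_val r u = word_val r v ->
  {subset u <= v}.
Proof.
move=> iu uv j ju; apply/negPn/negP => jv.
have := word_val_act uv (simple_root _ j); move/ffunP/(_ j).
rewrite (word_act_notin _ _ jv).
have := isolated_uniq iu; have := isolated_ge3 iu.
case/splitPr: ju => a b orth; rewrite cat_uniq /= negb_or.
case/and3P=> _ /andP[ja _] /andP[jb _]; rewrite word_act_cat word_act_notin //=.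
rewrite word_act_orthogonal => [|s sb]; last first.
  apply/eqP; rewrite cox_coef_eq0; last by apply: contraNneq jb => <-.
  by apply: orth; rewrite mem_cat inE ?eqxx ?sb !orbT.
rewrite /reflection coroot_simple_root cox_coef_diag !ffunE eqxx GRing.mulr1.
move/eqP; rewrite -GRing.subr_eq0 => /eqP E.
have : (2%:R == 0 :> algC)%R by rewrite -GRing.oppr_eq0 -E; apply/eqP; ring.
by rewrite Num.Theory.pnatr_eq0.
Qed.

Lemma reduced_expr_size u v w :
  reduced_expr r u w -> reduced_expr r v w -> size u = size v.
Proof.
by move=> [uw u_min] [vw v_min]; apply/eqP; rewrite eqn_leq u_min ?v_min.
Qed.

Lemma reduced_expr_same u v w : reduced_expr r u w ->
  word_val r v = word_val r u -> size v = size u -> reduced_expr r v w.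
Proof.
move=> [uw u_min] vu size_vu.
by split=> [|x xw]; rewrite ?vu ?size_vu ?u_min.
Qed.

(** The support of [u] is contained in [v], which has as many letters. *)
Lemma reduced_expr_perm u v w : isolated u -> reduced_expr r u w ->
  reduced_expr r v w -> perm_eq u v.
Proof.
move=> iu uw vw; have uv := isolated_support iu (etrans uw.1 (esym vw.1)).
have uU := isolated_uniq iu; have size_uv := reduced_expr_size uw vw.
have [_ uvE] := uniq_min_size uU uv (eq_leq (esym size_uv)).
by apply: uniq_perm => //; rewrite -(eq_uniq size_uv uvE).
Qed.

Lemma isolated_perm_reduced u v w : isolated u -> reduced_expr r u w ->
  perm_eq u v -> reduced_expr r v w.
Proof.
move=> iu uw uv; apply: (reduced_expr_same uw); last exact/esym/perm_size.
exact/esym/swaps_val/perm_swaps/uv/isolated_commute.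
Qed.

Lemma isolated_FC u w : isolated u -> reduced_expr r u w ->
  fully_commutative r w.
Proof.
move=> iu uw x y xw yw.
have ux := reduced_expr_perm iu uw xw; have uy := reduced_expr_perm iu uw yw.
apply: perm_swaps; last by rewrite -(permPl ux).
move=> s t; rewrite -!(perm_mem ux); exact: isolated_commute.
Qed.

Lemma isolated_CFC_involution u w : isolated u -> reduced_expr r u w ->
  (CFC r `&` involutions W) w.
Proof.
move=> iu uw; split.
  move=> x xw k; exists w; first exact: isolated_FC uw.
  apply: (isolated_perm_reduced iu uw).
  by rewrite (perm_trans (reduced_expr_perm iu uw xw)) // perm_sym perm_rot.
have [uwE _] := uw; rewrite /involutions /= expgS expg1 -{2}uwE.
rewrite -(invgK (word_val r u)) -word_val_rev.
have ru := isolated_perm_reduced iu uw (_ : perm_eq u (rev u)).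
by rewrite (ru _).1 ?mulgV // perm_sym perm_rev.
Qed.

Lemma reduced_expr_exists w : exists u, reduced_expr r u w.
Proof.
have [u uw] := rm.1 w.
have ex : exists n, `[< exists2 v, word_val r v = w & size v = n >].
  by exists (size u); apply/asboolP; exists u.
case: (ex_minnP ex) => n /asboolP[v vw vn] n_min; exists v; split=> // x xw.
by rewrite vn; apply: n_min; apply/asboolP; exists x.
Qed.

(** * Cyclically fully commutative involutions *)

Lemma CFC_rot_reduced u w k : CFC r w -> reduced_expr r u w ->
  exists x, reduced_expr r (rot k u) x.
Proof. by move=> wC uw; have [x _] := wC u uw k; exists x. Qed.

Lemma CFC_FC w : CFC r w -> fully_commutative r w.
Proof.
move=> wC; have [u uw] := reduced_expr_exists w.
have [x xFC] := wC u uw 0; rewrite rot0 => -[ux _].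
by have [uwE _] := uw; rewrite -uwE ux.
Qed.

Lemma swaps_rev u w : (CFC r `&` involutions W) w -> reduced_expr r u w ->
  swaps u (rev u).
Proof.
move=> [wC w2] uw; apply: (CFC_FC wC) => //.
apply: (reduced_expr_same uw); last exact: size_rev.
rewrite word_val_rev uw.1; apply: (mulgI w); rewrite mulgV.
by move: w2; rewrite /involutions /= expgS expg1.
Qed.

Lemma not_reduced_square s u w : ~ reduced_expr r (s :: s :: u) w.
Proof.
move=> [uw u_min]; have := u_min u; rewrite /= -uw !word_val_cons mulgA.
by rewrite gen_sqr mul1g => /(_ erefl); rewrite ltnNge leqnSn.
Qed.

Lemma last_filter_notin a t z : a \notin z ->
  last t (filter (pred2 a t) z) = t.
Proof.
elim: z => //= b z IH; rewrite inE negb_or => /andP[ab /IH zt].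
by rewrite (eq_sym b a) (negPf ab) /=; case: eqVneq => [->|].
Qed.

(** The reversal of the word is reached by swaps, and it ends with [a]; swaps
    keep the subword on a noncommuting pair [a], [t], so that this subword ends
    with [a] too, and [t] cannot occur after the last [a]. *)
Lemma commute_after_last a x y z w : (CFC r `&` involutions W) w ->
    reduced_expr r (a :: x) w -> a :: x = y ++ a :: z -> a \notin z ->
  {in z, forall t, commute (r a) (r t)}.
Proof.
move=> wCI ax xE az t tz; apply: contrapT => at_.
have last_a : last t (filter (pred2 a t) (a :: x)) = a.
  rewrite (swaps_filter at_ (swaps_rev wCI ax)).
  by rewrite filter_rev /= eqxx rev_cons last_rcons.
have tf : t \in filter (pred2 a t) z by rewrite mem_filter /= eqxx orbT.
move: last_a (last_filter_notin t az).
rewrite xE filter_cat last_cat [filter _ (a :: z)]/= eqxx /=.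
by case: (filter _ _) tf => //= b f _ -> ta; case: at_; rewrite ta.
Qed.

(** A second occurrence of [a] could be moved to the end of the word, and the
    cyclic shift bringing it to the front would start with the square of
    [a]. *)
Lemma first_letter_once a x w : (CFC r `&` involutions W) w ->
  reduced_expr r (a :: x) w -> a \notin x.
Proof.
move=> wCI ax; apply/negP => a_x.
have [y [z [xE az]]] : exists y z, x = y ++ a :: z /\ a \notin z.
  elim: x a_x {ax} => // b x IH; case: (boolP (a \in x)) => [ax _|ax].
    by have [y [z [-> az]]] := IH ax; exists (b :: y), z.
  by rewrite inE (negPf ax) orbF => /eqP <-; exists [::], x.
have aC : {in z, forall t, commute (r a) (r t)}.
  by apply: (commute_after_last (y := a :: y) wCI ax _ az); rewrite xE.
have ayza : reduced_expr r ((a :: y ++ z) ++ [:: a]) w.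
  apply: (reduced_expr_same ax); last first.
    by rewrite xE /= !size_cat /= addn1 addnS.
  apply/esym/swaps_val; rewrite xE /= -catA cats1.
  have := @swaps_cat (a :: y) [::] _ _ (swaps_front aC).
  by rewrite !cats0.
have [v] := CFC_rot_reduced (size (a :: y ++ z)) wCI.1 ayza.
by rewrite rot_size_cat; apply: not_reduced_square.
Qed.

Lemma first_letter_central a x w : (CFC r `&` involutions W) w ->
  reduced_expr r (a :: x) w -> {in x, forall t, commute (r a) (r t)}.
Proof.
move=> wCI ax; apply: (commute_after_last (y := [::]) wCI ax) => //.
exact: first_letter_once wCI ax.
Qed.

(** For words of CFC involutions, a cyclic shift is a sequence of commutations,
    as each letter that comes first commutes with all the others. *)
Lemma rot_reduced u w k : (CFC r `&` involutions W) w ->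
  reduced_expr r u w -> reduced_expr r (rot k u) w.
Proof.
move=> wCI uw; elim: k => [|k IH]; first by rewrite rot0.
case: (ltnP k (size u)) => ku; last by rewrite rot_oversize // ltnW.
rewrite -add1n rotD //; case ku': (rot k u) IH => [|a x] ax; first by [].
apply: (reduced_expr_same ax); last exact: size_rot.
rewrite rot1_cons; apply/esym/swaps_val/swaps_front.
exact: first_letter_central wCI ax.
Qed.

Lemma CFC_involution_isolated u w : (CFC r `&` involutions W) w ->
  reduced_expr r u w -> isolated u.
Proof.
move=> wCI uw s su; pose k := index s u.
have rotE := rot_index su; have kx := rot_reduced k wCI uw.
rewrite /k rotE in kx; have sx := first_letter_once wCI kx.
have sC := first_letter_central wCI kx.
have cnt t : count_mem t u = count_mem t (s :: drop k.+1 u ++ take k u).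
  by rewrite -rotE; apply/permP; rewrite perm_sym perm_rot.
split=> [|t st]; rewrite cnt /=; first by rewrite eqxx (count_memPn sx).
have ncomm : ~ commute (r s) (r t) by move/commute_gen; rewrite st.
have -> : (s == t) = false by apply/eqP => E; rewrite E in ncomm; apply: ncomm.
by apply/count_memPn/negP => /sC.
Qed.

(** Each of these elements is the product of the set of letters of an isolated
    word, taken in a fixed order. *)
Lemma finite_CFC_involutions : finite_set (CFC r `&` involutions W).
Proof.
apply: (@sub_finite_set _ _ (range (fun A : {set S} => word_val r (enum A)))).
  move=> w wCI; have [u uw] := reduced_expr_exists w.
  have iu := CFC_involution_isolated wCI uw.
  exists [set x in u]%SET => //.
  apply: (isolated_perm_reduced iu uw _).1; apply: uniq_perm.
  - exact: isolated_uniq.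
  - exact: enum_uniq.
  - by move=> x; rewrite mem_enum finset.in_set.
exact/finite_image/finite_finset.
Qed.

End CoxeterSystem.

Theorem theorem4p1 (S : finType) (m : coxeter_matrix S)
    (W : groupType) (r : S -> W) (rm : coxeter_system r m) :
  finite_set (CFC r `&` involutions W) /\
  forall w : W,
    ((CFC r `&` involutions W) w <->
       exists2 u, reduced_expr r u w &
         forall s, s \in u ->
           count_mem s u = 1%N /\
           forall t, cox_ge3 m s t -> count_mem t u = 0%N) /\
    ((CFC r `&` involutions W) w <->
       forall u, reduced_expr r u w ->
         forall s, s \in u ->
           count_mem s u = 1%N /\
           forall t, cox_ge3 m s t -> count_mem t u = 0%N).
Proof.
split=> [|w]; first exact: finite_CFC_involutions rm.
have [u uw] := reduced_expr_exists rm w.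
split; split=> [wCI|].
- by exists u => //; exact (CFC_involution_isolated rm wCI uw).
- by case=> v vw iv; exact (isolated_CFC_involution rm iv vw).
- by move=> v vw; exact (CFC_involution_isolated rm wCI vw).
- by move=> /(_ u uw) iu; exact (isolated_CFC_involution rm iu uw).
Qed.
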